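(* Let $k\ge 1$ and let $I=(i_1,\ldots,i_k)$ with $0\le i_1<\cdots<i_k$ and $J=(j_1,\ldots,j_k)$ with $0\le j_1<\cdots<j_k$ be integer sequences. Let $L^B_{I,J}$ be the submatrix of $L^B$ with rows indexed by $I$ and columns indexed by $J$, let $\mathbf{P}_I=(P_{i_1},\ldots,P_{i_k})$ and $\mathbf{P}'_J=(P'_{j_1},\ldots,P'_{j_k})$, and let $S_{I,J}$ be the set of nonintersecting families $\mathbf{p}=(p_1,\ldots,p_k)\in\mathcal{N}_{D^{L^B}}(\mathbf{P}_I,\mathbf{P}'_J)$ that satisfy none of the properties $(\mathcal{P}_1)$, $(\mathcal{P}_2)$, $(\mathcal{P}_3)$. Then $$\det\left[L^B_{I,J}\right]=GF(S_{I,J}),$$ the sum of the weights of all elements of $S_{I,J}$. In particular, $\det[L^B_{I,J}]$ is a polynomial in $q$ with nonnegative coefficients.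
   Context: $L^B=(l_{i,j})_{i,j\ge 0}$ is the infinite lower triangular matrix with entries in $\mathbb{Z}[q]$ given by $l_{i,i}=1$ for $i\ge0$, $l_{1,0}=1+q$, $l_{2,0}=2q$, $l_{i+1,i}=1+q$ for $i\ge 1$, $l_{i+2,i}=q$ for $i\ge 1$, and $l_{i,j}=0$ otherwise. (It is the coefficient matrix of the triangle $b_{n,0}=(1+q)b_{n-1,0}+2q\,b_{n-1,1}$, $b_{n,k}=b_{n-1,k-1}+(1+q)b_{n-1,k}+q\,b_{n-1,k+1}$.) The weighted directed graph $D^{L^B}$ has vertices $P_i=(0,-i)$, $Q_i=(1,-i)$, $P'_i=(2,-i)$ for $i\ge0$, and arcs: $P_i\to Q_i$ ($i\ge0$); $P_i\to Q_{i-1}$ ($i\ge1$); $Q_i\to P'_i$ ($i\ge0$); $Q_i\to P'_{i-1}$ ($i\ge2$); $P_1\to P'_0$; and two distinct parallel arcs $Q_1\overset{l}{\to}P'_0$ and $Q_1\overset{r}{\to}P'_0$. Weights: $P_1\to P'_0$ has weight $-1$, each $P_i\to Q_{i-1}$ ($i\ge1$) has weight $q$, all other arcs have weight $1$. (With these weights, $l_{i,j}$ equals the sum of weights of directed paths from $P_i$ to $P'_j$.) The weight of a directed path is the product of the weights of its arcs; the weight of a family of paths is the product of the weights of its paths. $\mathcal{N}_{D^{L^B}}(\mathbf{P}_I,\mathbf{P}'_J)$ is the set of tuples $(p_1,\ldots,p_k)$ of directed paths, $p_m$ from $P_{i_m}$ to $P'_{j_m}$, that are pairwise vertex-disjoint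 (nonintersecting). Properties of a family $\mathbf{p}=(p_1,\ldots,p_k)$: $(\mathcal{P}_1)$: $p_1$ is the path $P_1\to P'_0$ (the single arc). $(\mathcal{P}_2)$: $p_1$ is the path $P_1\to Q_1\overset{l}{\to}P'_0$. $(\mathcal{P}_3)$: there exists $l\ge2$ such that $p_m$ is the path $P_m\to Q_{m-1}\to P'_{m-1}$ for all $1\le m\le l-1$ and $p_l$ is the path $P_l\to Q_l\to P'_{l-1}$. *)

(* Defs.v *)
From HB Require Import structures.
From mathcomp Require Import all_boot all_order all_algebra.
From mathcomp Require Import boolp classical_sets cardinality fsbigop.

Set Implicit Arguments.
Unset Strict Implicit.
Unset Printing Implicit Defensive.

Import Order.TTheory GRing.Theory Num.Theory.
Local Open Scope classical_set_scope.
Local Open Scope ring_scope.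

(* The indeterminate q is 'X in {poly int}. *)
Definition LB (i j : nat) : {poly int} :=
  if i == j then 1
  else if i == j.+1 then 1 + 'X
  else if i == j.+2 then (if j == 0%N then 2%:R * 'X else 'X)
  else 0.

Definition LB_sub (k : nat) (I J : k.-tuple nat) : 'M[{poly int}]_k :=
  \matrix_(a < k, b < k) LB (tnth I a) (tnth J b).

Definition vertex : Type := (int * int)%type.
Definition vP (i : nat) : vertex := (0, - i%:Z).
Definition vQ (i : nat) : vertex := (1, - i%:Z).
Definition vP' (i : nat) : vertex := (2%:Z, - i%:Z).

(* Constructor indices are shifted so that every value of the type is an arc:
   see asrc and atgt for the endpoints. *)
Inductive arc : Type :=
  | aPQ of nat
  | aPQd of nat
  | aQP' of nat
  | aQP'd of nat
  | aP1P'0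
  | aQ1P'0l
  | aQ1P'0r.

Definition asrc (e : arc) : vertex :=
  match e with
  | aPQ i => vP i
  | aPQd i => vP i.+1
  | aQP' i => vQ i
  | aQP'd i => vQ i.+2
  | aP1P'0 => vP 1
  | aQ1P'0l => vQ 1
  | aQ1P'0r => vQ 1
  end.

Definition atgt (e : arc) : vertex :=
  match e with
  | aPQ i => vQ i
  | aPQd i => vQ i
  | aQP' i => vP' i
  | aQP'd i => vP' i.+1
  | aP1P'0 => vP' 0
  | aQ1P'0l => vP' 0
  | aQ1P'0r => vP' 0
  end.

Definition arc_weight (e : arc) : {poly int} :=
  match e with
  | aP1P'0 => - 1
  | aPQd _ => 'X
  | _ => 1
  end.

Definition arc_code (e : arc) : nat * nat :=
  match e with
  | aPQ i => (0, i)
  | aPQd i => (1, i)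
  | aQP' i => (2, i)
  | aQP'd i => (3, i)
  | aP1P'0 => (4, 0)
  | aQ1P'0l => (5, 0)
  | aQ1P'0r => (6, 0)
  end%N.

Definition arc_decode (c : nat * nat) : arc :=
  match c.1 with
  | 0 => aPQ c.2
  | 1 => aPQd c.2
  | 2 => aQP' c.2
  | 3 => aQP'd c.2
  | 4 => aP1P'0
  | 5 => aQ1P'0l
  | _ => aQ1P'0r
  end%N.

Lemma arc_codeK : cancel arc_code arc_decode.
Proof. by case. Qed.

HB.instance Definition _ := Countable.copy arc (can_type arc_codeK).

(* Arcs strictly increase the first coordinate, so the digraph is acyclic and
   a chain of consecutive arcs never repeats a vertex. *)
Lemma asrc_lt_atgt (e : arc) : (asrc e).1 < (atgt e).1.
Proof. by case: e. Qed.

(* A path is given by its arcs rather than its vertices, because of the two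
   parallel arcs from Q_1 to P'_0. *)
Definition dpath : Type := seq arc.

Fixpoint is_dpath (u v : vertex) (p : dpath) : bool :=
  if p is e :: p' then (asrc e == u) && is_dpath (atgt e) v p' else u == v.

Definition path_vertices (u : vertex) (p : dpath) : seq vertex :=
  u :: [seq atgt e | e <- p].

Definition path_weight (p : dpath) : {poly int} := \prod_(e <- p) arc_weight e.

Definition family (k : nat) : Type := k.-tuple dpath.

Definition family_weight (k : nat) (p : family k) : {poly int} :=
  \prod_(m < k) path_weight (tnth p m).

Definition nonintersecting (k : nat) (I J : k.-tuple nat) : set (family k) :=
  [set p | (forall m : 'I_k,
              is_dpath (vP (tnth I m)) (vP' (tnth J m)) (tnth p m)) /\
           (forall m n : 'I_k, m != n -> forall v : vertex,
              ~ (v \in path_vertices (vP (tnth I m)) (tnth p m) /\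
                 v \in path_vertices (vP (tnth I n)) (tnth p n)))].

(* The m-th path of the family, numbered from 1; the default [::] is never a
   path from some P_i to some P'_j. *)
Definition pth (k : nat) (p : family k) (m : nat) : dpath := nth [::] p m.-1.

Definition property1 (k : nat) (p : family k) : Prop := pth p 1 = [:: aP1P'0].

Definition property2 (k : nat) (p : family k) : Prop :=
  pth p 1 = [:: aPQ 1; aQ1P'0l].

Definition property3 (k : nat) (p : family k) : Prop :=
  exists l : nat,
    [/\ (2 <= l <= k)%N,
        forall m : nat, (1 <= m <= l.-1)%N ->
          pth p m = [:: aPQd m.-1; aQP' m.-1]
      & pth p l = [:: aPQ l; aQP'd l.-2]].

Definition S_IJ (k : nat) (I J : k.-tuple nat) : set (family k) :=
  [set p | [/\ nonintersecting I J p,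
               ~ property1 p, ~ property2 p & ~ property3 p]].

(* \sum_(p \in S) is the sum of finite support of fsbigop: it is 0 by
   convention when infinitely many elements of S have nonzero weight. *)
Definition GF (k : nat) (S : set (family k)) : {poly int} :=
  \sum_(p \in S) family_weight p.

(* Main.v *)
Require Import Defs.
From mathcomp Require Import all_boot all_order all_algebra all_fingroup.
From mathcomp Require Import boolp classical_sets cardinality fsbigop.
From mathcomp Require Import zify ring.

Set Implicit Arguments.
Unset Strict Implicit.
Unset Printing Implicit Defensive.

Import Order.TTheory GRing.Theory Num.Theory.
Local Open Scope classical_set_scope.
Local Open Scope ring_scope.

(** [LB] is a product of two bidiagonal matrices, one for each layer of arcs:
    the arc P_1 -> P'_0 may be replaced by a path of weight -1 through Q_0,
    since Q_0 leads only to P'_0. Expanding a minor of the product by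
    multilinearity in the rows and using that a minor of a bidiagonal matrix is
    the product of its diagonal entries turns the determinant into the signed
    sum over all nonintersecting families; those are the families whose
    middle vertices Q_i have strictly increasing indices.

    The families satisfying P1, P2 or P3 cancel in pairs. Given a family that
    starts with the arc P_1 -> P'_0, let P_m -> Q_(m-1) -> P'_(m-1), for
    2 <= m <= l, be the longest run of such paths following it. Then Q_l is
    free, and rerouting p_1 through Q_0 and p_l through Q_l changes the sign of
    the weight; the resulting families are those with P2 (l = 1) or P3. *)

(** * Vertices, arcs and the list of all paths from a P_i to a P'_j *)

Lemma vP_eq i j : (vP i == vP j) = (i == j).
Proof. by rewrite /vP xpair_eqE eqxx eqr_opp. Qed.

Lemma vQ_eq i j : (vQ i == vQ j) = (i == j).
Proof. by rewrite /vQ xpair_eqE eqxx eqr_opp. Qed.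

Lemma vP'_eq i j : (vP' i == vP' j) = (i == j).
Proof. by rewrite /vP' xpair_eqE eqxx eqr_opp. Qed.

Lemma vPQ_eq i j : (vP i == vQ j) = false. Proof. by []. Qed.
Lemma vQP_eq i j : (vQ i == vP j) = false. Proof. by []. Qed.
Lemma vPP'_eq i j : (vP i == vP' j) = false. Proof. by []. Qed.
Lemma vP'P_eq i j : (vP' i == vP j) = false. Proof. by []. Qed.
Lemma vQP'_eq i j : (vQ i == vP' j) = false. Proof. by []. Qed.
Lemma vP'Q_eq i j : (vP' i == vQ j) = false. Proof. by []. Qed.

Definition v_eq :=
  (vP_eq, vQ_eq, vP'_eq, vPQ_eq, vQP_eq, vPP'_eq, vP'P_eq, vQP'_eq, vP'Q_eq).

Definition arcs_QP' (m j : nat) : seq Defs.arc :=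
  if m == j then [:: aQP' m]
  else if m == j.+1 then
    if j is j'.+1 then [:: aQP'd j'] else [:: aQ1P'0l; aQ1P'0r]
  else [::].

Lemma arc_eqE (e f : Defs.arc) :
  (e == f) = ((arc_code e).1 == (arc_code f).1) && ((arc_code e).2 == (arc_code f).2).
Proof. by rewrite -(can_eq arc_codeK). Qed.

Lemma mem_arcs_QP' m j e :
  (e \in arcs_QP' m j) = (asrc e == vQ m) && (atgt e == vP' j).
Proof.
rewrite /arcs_QP'; case: (eqVneq m j) => [->|mj]; last first.
  case: (eqVneq m j.+1) => [->|mj1]; last first.
    by rewrite in_nil; case: e => [i|i|i|i|||] /=; rewrite ?v_eq //; lia.
  case: j mj => [|j] mj; rewrite !inE !arc_eqE;
    by case: e => [i|i|i|i|||] /=; rewrite ?v_eq //; lia.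
by rewrite inE arc_eqE; case: e => [i|i|i|i|||] /=; rewrite ?v_eq //; lia.
Qed.

Lemma arcs_QP'_band m j e : e \in arcs_QP' m j -> (j <= m <= j.+1)%N.
Proof.
rewrite /arcs_QP'; case: (eqVneq m j) => [->|_]; last case: eqP => [->|_];
  by rewrite ?leqnn ?leqnSn.
Qed.

Definition descends (p : dpath) : bool := if p is aPQ _ :: _ then false else true.

(* The arc P_1 -> P'_0 is booked with the descending paths, as if it went
   through Q_0: this is legitimate because Q_0 leads to P'_0 only. *)
Definition paths_via (d : bool) (i j : nat) : seq dpath :=
  if d then
    if i is i'.+1 then
      [seq [:: aPQd i'; e] | e <- arcs_QP' i' j] ++
      (if (i' == 0) && (j == 0) then [:: [:: aP1P'0]] else [::])
    else [::]
  else [seq [:: aPQ i; e] | e <- arcs_QP' i j].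

Lemma is_dpath_P' j k p : is_dpath (vP' j) (vP' k) p = (p == [::]) && (j == k).
Proof. by case: p => [|[i|i|i|i|||] p] /=; rewrite ?v_eq. Qed.

(** Every arc leaving Q_m ends in a sink P'_j, so exactly one arc remains to be travelled. *)
Lemma is_dpath_Q m j p :
  is_dpath (vQ m) (vP' j) p = if p is [:: e] then e \in arcs_QP' m j else false.
Proof.
case: p => [|e p] /=; first by rewrite v_eq.
have [/eqP es|es] := boolP (asrc e == vQ m); last first.
  by case: p => //; rewrite mem_arcs_QP' (negPf es).
have [j' et] : exists j', atgt e = vP' j'.
  by case: e es => [i|i|i|i|||] //= _; eexists.
by rewrite et is_dpath_P'; case: p => //=; rewrite mem_arcs_QP' es et eqxx v_eq.
Qed.

Lemma mem_paths_via d i j p :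
  (p \in paths_via d i j) = is_dpath (vP i) (vP' j) p && (descends p == d).
Proof.
have mem_map2 (e f : Defs.arc) s p' :
  (e :: p' \in [seq [:: f; x] | x <- s]) =
    (e == f) && (if p' is [:: x] then x \in s else false).
  apply/mapP/andP => [[x xs [-> ->]]|[/eqP ->]]; first by rewrite eqxx.
  by case: p' => [//|x [|//]] xs; exists x.
case: p => [|e p] /=.
  rewrite ?v_eq /paths_via; case: d; last by apply/mapP => -[].
  case: i => // i; rewrite mem_cat; case: ifP => _;
    by rewrite orbF; apply/mapP => -[].
rewrite /paths_via; case: d; last first.
  rewrite mem_map2; case: e => [n|n|n|n|||] /=; rewrite ?v_eq ?andbF //= ?is_dpath_Q.
  rewrite eqxx andbT; have [->|ni] := eqVneq n i; first by rewrite eqxx.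
  by case: eqP => // -[ni']; rewrite ni' eqxx in ni.
case: i => [|i].
  by case: e => [n|n|n|n|||] /=; rewrite ?v_eq ?andbF.
rewrite mem_cat mem_map2.
have -> : (e :: p \in (if (i == 0%N) && (j == 0%N) then [:: [:: aP1P'0]] else [::]))
   = [&& i == 0%N, j == 0%N, e == aP1P'0 & p == [::]].
  by do 2!case: eqP => //= _; rewrite inE.
case: e => [n|n|n|n|||] /=; rewrite ?v_eq ?andbF ?orbF ?andbT //= ?is_dpath_Q.
  rewrite eqSS; have [->|ni] := eqVneq n i; first by rewrite eqxx.
  by case: eqP => // -[ni']; rewrite ni' eqxx in ni.
rewrite is_dpath_P' eqSS [0%N == i]eq_sym [0%N == j]eq_sym.
by case: (p == _); case: (i == _); case: (j == _).
Qed.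

Lemma paths_via_uniq d i j : uniq (paths_via d i j).
Proof.
have arcs_uniq m : uniq (arcs_QP' m j).
  by rewrite /arcs_QP'; do 2!case: ifP => // _; case: (j).
have mapu (f : Defs.arc) m : uniq [seq [:: f; e] | e <- arcs_QP' m j].
  by rewrite map_inj_uniq // => x y [].
case: d; last exact: mapu.
case: i => // i; rewrite cat_uniq mapu /=.
by case: ifP => // _ /=; rewrite orbF andbT; apply/mapP => -[].
Qed.

(** * Factorisation of [LB] into two bidiagonal matrices *)

Definition wtPQ (i : nat) (d : bool) : {poly int} :=
  if d then (if i is i'.+1 then 'X - (i' == 0%N)%:R else 0) else 1.

Definition wtQP (m j : nat) : {poly int} := (size (arcs_QP' m j))%:R.

Lemma wtQP_band m j : wtQP m j != 0 -> (j <= m <= j.+1)%N.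
Proof.
rewrite /wtQP; case E: (arcs_QP' m j) => [|e r]; first by rewrite eqxx.
by move=> _; apply: (@arcs_QP'_band _ _ e); rewrite E mem_head.
Qed.

(** Only column 0 is irregular: the double arc out of Q_1 gives 2q in row 2, and in row 1 the
    correction -1 in [wtPQ] brings q + 2 down to q + 1. The truncation of [i - d] at 0 is harmless,
    since [wtPQ 0 true] is 0. *)
Lemma LB_factor i j : LB i j = \sum_d wtPQ i d * wtQP (i - d)%N j.
Proof.
rewrite big_bool /= subn0 mul1r /LB.
case: i => [|i].
  by rewrite mul0r add0r /wtQP /arcs_QP'; case: eqP.
rewrite subn1 /= /wtQP /arcs_QP'.
case: (eqVneq i.+1 j) => [<-|ij].
  by rewrite [i == i.+1]ltn_eqF // ?[i == i.+2]ltn_eqF // mulr0 add0r.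
rewrite !eqSS; case: (eqVneq i j) => [->|ij1].
  by case: j {ij} => [|j] /=; ring.
case: (eqVneq i j.+1) => [->|ij2].
  by case: j {ij ij1} => [|j] /=; ring.
by rewrite mulr0 addr0.
Qed.

(** The arc P_1 -> P'_0 contributes -1 only for i = 1 and j = 0, which is exactly where the
    correction in [wtPQ] survives multiplication by [wtQP 0 j]. *)
Lemma sum_paths_via d i j :
  \sum_(p <- paths_via d i j) path_weight p = wtPQ i d * wtQP (i - d)%N j.
Proof.
have sum_out (e : Defs.arc) m :
    \sum_(p <- [seq [:: e; x] | x <- arcs_QP' m j]) path_weight p =
    arc_weight e * wtQP m j.
  rewrite big_map /wtQP -sum1_size natr_sum mulr_sumr.
  rewrite big_seq [RHS]big_seq; apply: eq_bigr => x.
  rewrite mem_arcs_QP' => /andP[xs _]; rewrite /path_weight !big_cons big_nil.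
  by congr (_ * _); case: x xs => //= *; rewrite mulr1.
case: d => /=; last by rewrite sum_out subn0.
case: i => [|i]; first by rewrite big_nil mul0r.
rewrite big_cat sum_out subn1 /= mulrBl; congr (_ + _).
case: (eqVneq i 0%N) => [->|_] /=; last by rewrite big_nil mul0r oppr0.
case: (eqVneq j 0%N) => [->|j0] /=.
  by rewrite big_seq1 /path_weight big_seq1 /wtQP /= !mul1r.
by rewrite big_nil /wtQP /arcs_QP'; case: (j) j0 => //= j1 _; rewrite mulr0 oppr0.
Qed.

(** * Expansion of the determinant over the choices of middle vertices *)

Lemma det_sum_rows (R : comNzRingType) k (T : finType)
    (A : 'I_k -> T -> R) (B : 'I_k -> T -> 'I_k -> R) :
  \det (\matrix_(a, b) \sum_t A a t * B a t b) =
  \sum_(f : {ffun 'I_k -> T})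
    (\prod_a A a (f a)) * \det (\matrix_(a, b) B a (f a) b).
Proof.
under [RHS]eq_bigr => f _ do rewrite /determinant mulr_sumr.
rewrite exchange_big; apply: eq_bigr => s _.
under eq_bigr => a _ do rewrite mxE.
rewrite bigA_distr_bigA mulr_sumr; apply: eq_bigr => f _.
rewrite big_split mulrCA; congr (_ * (_ * _)).
by apply: eq_bigr => a _; rewrite mxE.
Qed.

(** An increasing self-map of ['I_k] satisfies a <= t a; this is applied to [s] and to its
    inverse. *)
Lemma perm_homo_ltn1 k (s : 'S_k) :
  {homo s : a b / (a < b)%N} -> s = 1%g.
Proof.
move=> hs.
have ge_id (t : 'S_k) : {homo t : a b / (a < b)%N} -> forall a : 'I_k, (a <= t a)%N.
  move=> ht [a]; elim: a => [//|a IH] lt_a.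
  by apply: leq_ltn_trans (IH (ltnW lt_a)) _; apply: ht.
have hsV : {homo (s^-1)%g : a b / (a < b)%N}.
  move=> a b ab; rewrite ltnNge; apply: contraL ab; rewrite -leqNgt leq_eqVlt.
  case/orP => [/eqP/val_inj/perm_inj->//|/hs]; rewrite !permKV; exact: ltnW.
apply/permP => a; rewrite perm1; apply: val_inj; apply/eqP.
rewrite eqn_leq (ge_id s) // andbT.
by have := ge_id _ hsV (s a); rewrite permK.
Qed.

(** A permutation with an inversion a < b, s b < s a and a nonzero term would give m b <= j (s b) +
    1 <= j (s a) <= m a, against m a < m b. *)
Lemma det_bidiagonal_minor (R : comNzRingType) k (F : nat -> nat -> R)
    (m j : 'I_k -> nat) :
  (forall x y, F x y != 0 -> (y <= x <= y.+1)%N) ->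
  {homo m : a b / (a < b)%N} -> {homo j : a b / (a < b)%N} ->
  \det (\matrix_(a, b) F (m a) (j b)) = \prod_a F (m a) (j a).
Proof.
move=> bandF hm hj; rewrite /determinant (bigD1 1%g) //= [X in _ + X]big1.
  rewrite addr0 odd_perm1 mul1r; apply: eq_bigr => a _.
  by rewrite mxE perm1.
move=> s s1; apply/eqP; apply: contraNT s1 => nz; apply/eqP/perm_homo_ltn1.
have nzF a : F (m a) (j (s a)) != 0.
  apply: contraNneq nz => Fa0; rewrite (bigD1 a) //= mxE Fa0.
  by rewrite mul0r mulr0.
move=> a b ab; rewrite ltnNge leq_eqVlt; apply/negP => /orP[].
  by move=> /eqP/val_inj/perm_inj ba; rewrite ba ltnn in ab.
move=> /hj sba; have := bandF _ _ (nzF a); have := bandF _ _ (nzF b).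
have := hm _ _ ab; lia.
Qed.

Lemma sorted_tnth k (t : k.-tuple nat) :
  sorted ltn t -> {homo tnth t : a b / (a < b)%N}.
Proof.
move=> st a b ab; rewrite !(tnth_nth 0%N).
by apply: (sorted_ltn_nth ltn_trans) => //; rewrite inE size_tuple.
Qed.

(** [f a] tells whether the a-th path descends, so [tnth I a - f a] is the index of its middle
    vertex. *)
Definition strict_mids k (I : k.-tuple nat) (f : {ffun 'I_k -> bool}) : bool :=
  [forall a : 'I_k, forall b : 'I_k, (a < b)%N ==> (tnth I a - f a < tnth I b - f b)%N].

Lemma strict_midsP k (I : k.-tuple nat) (f : {ffun 'I_k -> bool}) :
  reflect {homo (fun a => (tnth I a - f a)%N) : a b / (a < b)%N}
          (strict_mids I f).
Proof.
apply: (iffP forallP) => [h a b|h a]; first by move/forallP: (h a) => /(_ b)/implyP.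
by apply/forallP => b; apply/implyP; apply: h.
Qed.

Lemma det_LB_sub k (I J : k.-tuple nat) :
  sorted ltn I -> sorted ltn J ->
  \det (LB_sub I J) =
  \sum_(f | strict_mids I f)
    \prod_a (wtPQ (tnth I a) (f a) * wtQP (tnth I a - f a)%N (tnth J a)).
Proof.
move=> hI hJ.
have -> : LB_sub I J = \matrix_(a, b) \sum_(d : bool)
    wtPQ (tnth I a) d * wtQP (tnth I a - d)%N (tnth J b).
  by apply/matrixP => a b; rewrite !mxE LB_factor.
rewrite det_sum_rows [RHS]big_mkcond; apply: eq_bigr => f _.
case: strict_midsP => [hf|nhf].
  rewrite big_split; congr (_ * _).
  exact: (det_bidiagonal_minor wtQP_band hf (sorted_tnth hJ)).
(* A descent lowers an index by at most 1, so the middle indices increase weakly; where they fail to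
   increase strictly two of them agree, and the minor has two equal rows. *)
have [a [b [ab hab]]] : exists a b : 'I_k,
    (a < b)%N /\ (tnth I a - f a = tnth I b - f b)%N.
  apply: contrapT => nex; apply: nhf => a b ab; rewrite ltn_neqAle; apply/andP.
  split; first by apply/eqP => hab; apply: nex; exists a, b.
  by have := sorted_tnth hI ab; case: (f a); case: (f b); lia.
rewrite (@determinant_alternate _ _ _ a b) ?mulr0 //.
  by apply/eqP => ba; rewrite ba ltnn in ab.
by move=> c; rewrite !mxE hab.
Qed.

(** * Nonintersecting families described by their middle vertices *)

Lemma dpath_vertices i j p : is_dpath (vP i) (vP' j) p ->
  [/\ i = 1%N, j = 0%N & p = [:: aP1P'0]] \/
  [/\ (descends p <= i)%N, (j <= i - descends p <= j.+1)%N &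
      path_vertices (vP i) p = [:: vP i; vQ (i - descends p); vP' j]].
Proof.
move=> ip; have : p \in paths_via (descends p) i j by rewrite mem_paths_via ip eqxx.
case: (descends p) => /=.
  case: i ip => // i _; rewrite mem_cat => /orP[/mapP[e ej ->]|].
    right; rewrite subn1 /=; split => //; first exact: arcs_QP'_band ej.
    by move: ej; rewrite mem_arcs_QP' /path_vertices /= => /andP[_ /eqP->].
  by do 2!case: eqP => //= ->; rewrite inE => /eqP ->; left.
case/mapP => e ej ->; right; rewrite subn0; split => //; first exact: arcs_QP'_band ej.
by move: ej; rewrite mem_arcs_QP' /path_vertices /= => /andP[_ /eqP->].
Qed.

(** For the arc P_1 -> P'_0, which has no middle vertex, this gives 0, the index of the virtual
    Q_0. *)
Definition mid k (I : k.-tuple nat) (p : Defs.family k) (a : 'I_k) : nat :=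
  (tnth I a - descends (tnth p a))%N.

Definition valid_family k (I J : k.-tuple nat) (p : Defs.family k) : Prop :=
  (forall a, is_dpath (vP (tnth I a)) (vP' (tnth J a)) (tnth p a)) /\
  {homo mid I p : a b / (a < b)%N}.

(** Sources are distinct and so are sinks, hence two paths can only meet in a Q; since middle
    indices increase weakly, avoiding this means that they increase strictly. *)
Lemma nonintersectingE k (I J : k.-tuple nat) (p : Defs.family k) :
  sorted ltn I -> sorted ltn J ->
  nonintersecting I J p <-> valid_family I J p.
Proof.
move=> /sorted_tnth hI /sorted_tnth hJ; split=> -[pd H]; split=> //.
  move=> a b ab; rewrite /mid.
  have := hI _ _ ab; have := hJ _ _ ab => Jab Iab.
  have [[Ia Ja pa]|[dla ja va]] := dpath_vertices (pd a).
    (* The virtual middle index of P_1 -> P'_0 is 0, and a later path starts at index at least 2, so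
       its middle index is positive. *)
    by rewrite pa Ia /= in Iab *; case: (descends _); lia.
  have [[Ib Jb pb]|[dlb jb vb]] := dpath_vertices (pd b).
    by rewrite Jb in Jab.
  have nab : a != b by apply: contraTneq ab => ->; rewrite ltnn.
  have := H a b nab (vQ (mid I p a)); rewrite va vb !inE !v_eq eqxx /=.
  by rewrite /mid; move: (descends _) (descends _) dla dlb => [] [] /=; lia.
have lt_disj (a b : 'I_k) v : (a < b)%N ->
    v \in path_vertices (vP (tnth I a)) (tnth p a) ->
    v \in path_vertices (vP (tnth I b)) (tnth p b) -> False.
  move=> ab; have := H _ _ ab; rewrite /mid.
  have := hI _ _ ab; have := hJ _ _ ab => Jab Iab.
  have [[Ia Ja ->]|[_ _ ->]] := dpath_vertices (pd a);
    have [[Ib Jb ->]|[_ _ ->]] := dpath_vertices (pd b); rewrite ?inE /= => mab;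
    repeat (case/orP); move=> /eqP ->; rewrite ?v_eq //=; lia.
move=> a b; rewrite -val_eqE neq_ltn => /orP[] ab v [va vb].
  exact: lt_disj va vb.
exact: lt_disj vb va.
Qed.

(** All paths that can occur lie in the finite list [s], so families become finite functions into
    [seq_sub s], which are then grouped by their pattern of descents. *)
Lemma sum_nonintersecting k (I J : k.-tuple nat) :
  sorted ltn I -> sorted ltn J ->
  finite_set (nonintersecting I J) /\
  \sum_(p \in nonintersecting I J) family_weight p =
  \sum_(f | strict_mids I f)
    \prod_a (wtPQ (tnth I a) (f a) * wtQP (tnth I a - f a) (tnth J a)).
Proof.
move=> hI hJ.
pose s : seq dpath := undup (flatten
  [seq paths_via ad.2 (tnth I ad.1) (tnth J ad.1) | ad : ('I_k * bool)%type]).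
have mem_s a d q : q \in paths_via d (tnth I a) (tnth J a) -> q \in s.
  move=> qp; rewrite mem_undup; apply/flattenP; exists (paths_via d (tnth I a) (tnth J a)) => //.
  by apply/mapP; exists (a, d); rewrite ?mem_enum.
pose h (g : {ffun 'I_k -> seq_sub s}) : Defs.family k := [tuple ssval (g a) | a < k].
have h_inj : injective h.
  move=> g1 g2 eqh; apply/ffunP => a; apply: val_inj => /=.
  by have := congr1 (fun t => tnth t a) eqh; rewrite !tnth_mktuple.
pose r := codom h.
have r_uniq : uniq r by apply/injectiveP.
have sub_r p : nonintersecting I J p -> p \in r.
  move=> [pd _]; apply/codomP.
  have ps a : tnth p a \in s.
    by apply: (mem_s a (descends (tnth p a))); rewrite mem_paths_via pd eqxx.
  exists [ffun a => SeqSub (ps a)]; apply: eq_from_tnth => a.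
  by rewrite tnth_mktuple ffunE.
split; first exact: (sub_finite_set sub_r (finite_seq r)).
pose P := [pred p | `[< nonintersecting I J p >]].
have -> : nonintersecting I J = [set` P].
  by apply/seteqP; split=> p /= /asboolP.
rewrite -(@bigfs _ _ _ _ r) //; last first.
  by move=> p /asboolP/sub_r ->.
rewrite /r big_image_cond /=.
pose ds (g : {ffun 'I_k -> seq_sub s}) := [ffun a => descends (ssval (g a))].
(* Once the pattern of descents is fixed, the remaining conditions bear on each path separately;
   this is what lets the sum factor. *)
have PhE g : `[< nonintersecting I J (h g) >] = strict_mids I (ds g) &&
    [forall a, ssval (g a) \in paths_via (ds g a) (tnth I a) (tnth J a)].
  apply/asboolP/andP => [/nonintersectingE[]//|[/strict_midsP st /forallP vg]].
    move=> hd hm; split.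
      apply/strict_midsP => a b /hm; by rewrite /mid !tnth_mktuple !ffunE.
    apply/forallP => a; rewrite mem_paths_via ffunE eqxx andbT.
    by have := hd a; rewrite tnth_mktuple.
  apply/nonintersectingE => //; split=> [a|a b /st].
    by have := vg a; rewrite mem_paths_via tnth_mktuple => /andP[].
  by rewrite /mid !tnth_mktuple !ffunE.
rewrite (partition_big ds (strict_mids I)) /=; last first.
  by move=> g; rewrite PhE => /andP[].
apply: eq_bigr => f sf.
(* Each factor becomes a sum over the common index type [seq_sub s], so that the product of sums
   distributes into a sum over functions. *)
rewrite (eq_bigr (fun a => \sum_(t : seq_sub s |
    ssval t \in paths_via (f a) (tnth I a) (tnth J a)) path_weight (ssval t))); last first.
  move=> a _; rewrite -sum_paths_via -(big_map (@ssval _ s)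
    (mem (paths_via (f a) (tnth I a) (tnth J a))) path_weight) -big_filter.
  apply: perm_big; apply: uniq_perm.
  - exact: paths_via_uniq.
  - by rewrite filter_uniq // map_inj_uniq ?index_enum_uniq //; apply: val_inj.
  - move=> q; rewrite mem_filter; apply/idP/andP => [qp|[]//]; split=> //.
    by apply/mapP; exists (SeqSub (mem_s _ _ _ qp)); rewrite ?mem_index_enum.
rewrite bigA_distr_big_dep; apply: eq_big => [g|g _]; last first.
  by apply: eq_bigr => a _; rewrite tnth_mktuple.
rewrite PhE; apply/andP/familyP => [[/andP[_ /forallP vg] /eqP <-] a|vg].
  exact: vg.
have dsg : ds g = f.
  apply/ffunP => a; rewrite ffunE.
  have : ssval (g a) \in paths_via (f a) (tnth I a) (tnth J a) := vg a.
  by rewrite mem_paths_via => /andP[_ /eqP].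
by rewrite dsg eqxx sf; split=> //; apply/forallP => a; apply: vg.
Qed.

(** * The local moves that pair off the cancelling families *)

Definition path_dn (m : nat) : dpath := [:: aPQd m; aQP' m].

(** The path P_(m+1) -> Q_(m+1) -> P'_m, with the same ends as [path_dn m]; at m = 0 the left one of
    the two parallel arcs is taken, as in property 2. *)
Definition path_low (m : nat) : dpath :=
  if m is m'.+1 then [:: aPQ m'.+2; aQP'd m'] else [:: aPQ 1; aQ1P'0l].

Definition path_star : dpath := [:: aP1P'0].

Lemma is_dpath_dn i j m :
  is_dpath (vP i) (vP' j) (path_dn m) = (i == m.+1) && (j == m).
Proof. by rewrite /= ?v_eq eqxx /= eq_sym [m == _]eq_sym. Qed.

Lemma is_dpath_low i j m :
  is_dpath (vP i) (vP' j) (path_low m) = (i == m.+1) && (j == m).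
Proof.
by case: m => [|m]; rewrite /= ?v_eq ?eqxx /= [_ == i]eq_sym [_ == j]eq_sym.
Qed.

Lemma is_dpath_star i j :
  is_dpath (vP i) (vP' j) path_star = (i == 1%N) && (j == 0%N).
Proof. by rewrite /= ?v_eq [_ == i]eq_sym [_ == j]eq_sym. Qed.

Lemma descends_low m : descends (path_low m) = false.
Proof. by case: m. Qed.

Lemma path_low_neq_dn m n : path_low m <> path_dn n.
Proof. by case: m. Qed.

Lemma path_low_neq_star m : path_low m <> path_star.
Proof. by case: m. Qed.

Lemma path_weight_dn m : path_weight (path_dn m) = 'X.
Proof. by rewrite /path_weight !big_cons big_nil /= !mulr1. Qed.

Lemma path_weight_low m : path_weight (path_low m) = 1.
Proof. by case: m => [|m]; rewrite /path_weight !big_cons big_nil /= !mulr1. Qed.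

Lemma path_weight_star : path_weight path_star = -1.
Proof. by rewrite /path_weight big_seq1. Qed.

Definition set_path k (p : Defs.family k) (a : 'I_k) (x : dpath) : Defs.family k :=
  [tuple if b == a then x else tnth p b | b < k].

Lemma family_weight_set_path k (p : Defs.family k) a x :
  family_weight (set_path p a x) * path_weight (tnth p a) =
  family_weight p * path_weight x.
Proof.
rewrite /family_weight (bigD1 a) //= tnth_mktuple eqxx [in RHS](bigD1 a) //=.
rewrite (eq_bigr (fun b => path_weight (tnth p b))); first by ring.
by move=> b ba; rewrite tnth_mktuple (negPf ba).
Qed.

(* Families are indexed from 0: the paths that the informal numbering calls p_1
   and p_l sit at [ord0] and at index l - 1. So [star_at] refines property 1,
   [low_at ord0] is property 2, and [low_at] elsewhere is property 3. *)
Definition star_at k (l : 'I_k.+1) (p : Defs.family k.+1) : Prop :=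
  [/\ tnth p ord0 = path_star,
      forall b : 'I_k.+1, (0 < b <= l)%N -> tnth p b = path_dn b
    & forall b : 'I_k.+1, b = l.+1 :> nat -> tnth p b <> path_dn b].

Definition low_at k (l : 'I_k.+1) (p : Defs.family k.+1) : Prop :=
  (forall b : 'I_k.+1, (b < l)%N -> tnth p b = path_dn b) /\
  tnth p l = path_low l.

(** When [l] is [ord0] the outer [set_path] overrides the inner one, so that only the first path
    changes; the same holds for [to_star]. *)
Definition to_low k (l : 'I_k.+1) (p : Defs.family k.+1) : Defs.family k.+1 :=
  set_path (set_path p ord0 (path_dn 0)) l (path_low l).

Definition to_star k (l : 'I_k.+1) (p : Defs.family k.+1) : Defs.family k.+1 :=
  set_path (set_path p l (path_dn l)) ord0 path_star.

(** The shorter of two different runs would be followed by a [path_dn], against its maximality. *)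
Lemma star_at_uniq k (l l' : 'I_k.+1) p : star_at l p -> star_at l' p -> l = l'.
Proof.
wlog ll' : l l' / (l <= l')%N.
  by move=> W; case: (leqP l l') => [/W//|/ltnW/W h ? ?]; apply/esym/h.
move=> [_ _ nd] [_ d' _]; apply/val_inj/eqP; rewrite eqn_leq ll' /= leqNgt.
apply/negP => lt; have lk := leq_ltn_trans lt (ltn_ord l').
by apply: (nd (Ordinal lk)) => //; apply: d'.
Qed.

Lemma low_at_uniq k (l l' : 'I_k.+1) p : low_at l p -> low_at l' p -> l = l'.
Proof.
wlog ll' : l l' / (l <= l')%N.
  by move=> W; case: (leqP l l') => [/W//|/ltnW/W h ? ?]; apply/esym/h.
move=> [_ pl] [d' _]; apply/val_inj/eqP; rewrite eqn_leq ll' /= leqNgt.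
by apply/negP => /d'; rewrite pl; apply: path_low_neq_dn.
Qed.

Lemma star_at_low_at k (l l' : 'I_k.+1) p : star_at l p -> ~ low_at l' p.
Proof.
move=> [p0 _ _] [d' pl']; case: (posnP l') => [l0|/(d' ord0)]; last by rewrite p0.
have e : l' = ord0 by apply: val_inj.
by move: pl'; rewrite e p0 => /esym; apply: path_low_neq_star.
Qed.

Lemma to_lowK k (l : 'I_k.+1) p : star_at l p -> to_star l (to_low l p) = p.
Proof.
move=> [p0 pd _]; apply: eq_from_tnth => b; rewrite !tnth_mktuple.
case: (eqVneq b ord0) => [->//|b0]; case: (eqVneq b l) => [bl|//].
by rewrite pd bl // lt0n leqnn andbT -bl.
Qed.

Lemma to_starK k (l : 'I_k.+1) p : low_at l p -> to_low l (to_star l p) = p.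
Proof.
move=> [pd pl]; apply: eq_from_tnth => b; rewrite !tnth_mktuple.
case: (eqVneq b l) => [->//|bl]; case: (eqVneq b ord0) => [b0|//].
by rewrite pd b0 // lt0n; apply: contraNneq bl => l0; apply/eqP/val_inj; rewrite b0.
Qed.

Lemma low_at_to_low k (l : 'I_k.+1) p : star_at l p -> low_at l (to_low l p).
Proof.
move=> [_ pd _]; split; last by rewrite tnth_mktuple eqxx.
move=> b bl; rewrite !tnth_mktuple.
have /negPf-> : b != l by apply: contraTneq bl => ->; rewrite ltnn.
case: (eqVneq b ord0) => [->//|b0].
by apply: pd; rewrite lt0n b0 ltnW.
Qed.

(** For l > 0 the two rerouted paths weigh -1 and q before, q and 1 after; for l = 0 the single
    weight -1 becomes 1. *)
Lemma family_weight_to_low k (l : 'I_k.+1) p :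
  star_at l p -> family_weight (to_low l p) = - family_weight p.
Proof.
move=> [p0 pd _].
have := family_weight_set_path p ord0 (path_dn 0).
have := family_weight_set_path (set_path p ord0 (path_dn 0)) l (path_low l).
rewrite -/(to_low l p) tnth_mktuple.
have -> : (if l == ord0 then path_dn 0 else tnth p l) = path_dn l.
  by case: (eqVneq l ord0) => [->//|l0]; rewrite pd // lt0n l0 leqnn.
rewrite p0 path_weight_star path_weight_low !path_weight_dn mulr1 => <-.
(* Both exchange identities combine into the claim multiplied by ['X], which is cancelled. *)
rewrite mulrN1 -mulNr => /(mulIf (negbT (polyX_eq0 _))) <-.
by rewrite opprK.
Qed.

(** The point is that Q_(l+1) is free: the next path could use it only by being [path_dn l.+1],
    which the maximality of the run excludes. *)
Lemma valid_to_low k (I J : k.+1.-tuple nat) (l : 'I_k.+1) p :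
  sorted ltn I -> sorted ltn J ->
  star_at l p -> valid_family I J p -> valid_family I J (to_low l p).
Proof.
move=> /sorted_tnth hI /sorted_tnth hJ [p0 pd nd] [dp hm].
have /andP[/eqP Il /eqP Jl] : (tnth I l == l.+1) && (tnth J l == l).
  have := dp l; case: (eqVneq l ord0) => [->|l0]; first by rewrite p0 is_dpath_star.
  by rewrite pd ?is_dpath_dn // lt0n l0 leqnn.
split=> [a|a b ab].
  rewrite !tnth_mktuple; case: (eqVneq a l) => [->|al].
    by rewrite is_dpath_low Il Jl !eqxx.
  case: (eqVneq a ord0) => [a0|//].
  by have := dp ord0; rewrite a0 p0 is_dpath_star is_dpath_dn.
have midE c : c != l -> mid I (to_low l p) c = mid I p c.
  move=> cl; rewrite /mid !tnth_mktuple (negPf cl).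
  by case: (eqVneq c ord0) => [->|//]; rewrite p0.
have midl : mid I (to_low l p) l = l.+1.
  by rewrite /mid !tnth_mktuple eqxx descends_low subn0.
case: (eqVneq a l) => [al|al]; last first.
  rewrite (midE a) //; case: (eqVneq b l) => [bl|bl]; last by rewrite midE ?hm.
  rewrite bl midl; have := hm _ _ ab; rewrite bl /mid Il; lia.
have bl : b != l by apply: contraTneq ab => ->; rewrite al ltnn.
rewrite al midl midE //; rewrite al in ab.
(* Middle indices increase along the family, so it suffices to bound that of the immediate successor
   [c] of [l]. *)
have lk : (l.+1 < k.+1)%N := leq_ltn_trans ab (ltn_ord b).
pose c := Ordinal lk; have lc : (l < c)%N by [].
apply: (@leq_trans (mid I p c)); last first.
  by move: ab; rewrite leq_eqVlt => /orP[/eqP/(@val_inj _ _ _ c b)->|/(hm c)/ltnW].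
have Ic := hI _ _ lc; have Jc := hJ _ _ lc; rewrite Il in Ic; rewrite Jl in Jc.
rewrite ltnNge; apply/negP => mc.
have [[Ic1 _ _]|[_ Jc' _]] := dpath_vertices (dp c); first by rewrite Ic1 in Ic.
have pc : tnth p c \in paths_via (descends (tnth p c)) (tnth I c) (tnth J c).
  by rewrite mem_paths_via dp eqxx.
rewrite /mid in mc; move: pc Jc' mc; case: (descends _) => pc Jc' mc; last by lia.
have IcE : tnth I c = l.+2 by lia.
have JcE : tnth J c = l.+1 by lia.
move: pc; rewrite IcE JcE /= /arcs_QP' eqxx cats0 inE => /eqP.
exact: nd.
Qed.

(** Up to [l] the sources and sinks are forced to be P_(b+1) and P'_b. The middle index at [l] drops
    from l + 1 to l, still above the indices b < l of the preceding paths. *)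
Lemma valid_to_star k (I J : k.+1.-tuple nat) (l : 'I_k.+1) p :
  low_at l p -> valid_family I J p -> valid_family I J (to_star l p).
Proof.
move=> [pd pl] [dp hm].
have IJ (b : 'I_k.+1) : (b <= l)%N -> (tnth I b == b.+1) && (tnth J b == b).
  rewrite leq_eqVlt; have := dp b => + /orP[/eqP/val_inj bl|bl].
    by rewrite bl pl is_dpath_low.
  by rewrite pd // is_dpath_dn.
have /andP[/eqP Il /eqP Jl] := IJ l (leqnn _).
split=> [a|a b ab].
  rewrite !tnth_mktuple; case: (eqVneq a ord0) => [->|a0].
    by rewrite is_dpath_star; apply: (IJ ord0).
  case: (eqVneq a l) => [->|//].
  by rewrite is_dpath_dn Il Jl !eqxx.
have midE c : c != l -> mid I (to_star l p) c = mid I p c.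
  move=> cl; rewrite /mid !tnth_mktuple (negPf cl).
  case: (eqVneq c ord0) => [c0|//]; rewrite pd // c0 lt0n.
  by apply: contraNneq cl => l0; apply/eqP/val_inj; rewrite c0.
have midl : mid I (to_star l p) l = l.
  rewrite /mid !tnth_mktuple eqxx Il.
  by case: ifP; rewrite subn1.
have midl' : mid I p l = l.+1 by rewrite /mid pl descends_low subn0.
case: (eqVneq b l) => [bl|bl].
  rewrite bl in ab *; rewrite midl midE; last by apply: contraTneq ab => ->; rewrite ltnn.
  have /andP[/eqP Ia _] := IJ a (ltnW ab).
  by rewrite /mid pd // Ia subn1.
rewrite (midE b) //; have := hm _ _ ab.
case: (eqVneq a l) => [->|al]; last by rewrite midE.
by rewrite midl midl'; apply: ltnW.
Qed.

(** The run is maximal because a following [path_dn l.+1] would have met [path_low l] in Q_(l+1) in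
    the original family. *)
Lemma star_at_to_star k (I J : k.+1.-tuple nat) (l : 'I_k.+1) p :
  low_at l p -> valid_family I J p -> star_at l (to_star l p).
Proof.
move=> [pd pl] [dp hm]; split=> [|b|b bl].
- by rewrite tnth_mktuple eqxx.
- case/andP => b0 bl; rewrite !tnth_mktuple -[b == ord0]val_eqE eqn0Ngt b0 /=.
  case: (eqVneq b l) => [->//|bl'].
  by apply: pd; rewrite ltn_neqAle bl -val_eqE /= in bl' *; rewrite bl'.
have lb : (l < b)%N by rewrite bl.
have /negPf bl' : b != l by apply: contraTneq lb => ->; rewrite ltnn.
have /negPf b0 : b != ord0 by rewrite -val_eqE /= bl.
rewrite !tnth_mktuple bl' b0 => pb.
have := hm _ _ lb; rewrite /mid pl pb descends_low subn0.
have := dp l; rewrite pl is_dpath_low => /andP[/eqP -> _].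
have := dp b; rewrite pb is_dpath_dn => /andP[/eqP -> _] /=.
by rewrite bl subn1 ltnn.
Qed.

(** * The sign-reversing involution and the vanishing of the cancelling part *)

Lemma fsum_sign_reversing (R : idomainType) (T : choiceType) (X : set T)
    (phi : T -> T) (w : T -> R) :
  2%:R != 0 :> R ->
  (forall p, X p -> X (phi p)) -> (forall p, X p -> phi (phi p) = p) ->
  (forall p, X p -> w (phi p) = - w p) ->
  \sum_(p \in X) w p = 0.
Proof.
move=> nz2 Xphi phiK wphi.
have sumN : \sum_(p \in X) w p = - \sum_(p \in X) w p.
  (* Being its own inverse on [X], [phi] permutes [X]; reindexing makes the sum equal to its
     opposite. *)
  rewrite {1}(reindex_fsbig phi X X); last first.
    split=> [p|p q|p Xp]; first exact: Xphi.
      by rewrite !inE => Xp Xq /(congr1 phi); rewrite !phiK.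
    by exists (phi p); [exact: Xphi|exact: phiK].
  rewrite -mulN1r mulr_fsumr; apply: eq_fsbigr => p.
  by rewrite inE mulN1r => /wphi.
apply: (mulfI nz2); rewrite mulr0 mulr_natl mulr2n {1}sumN.
exact: addNr.
Qed.

Lemma ex_star_at k (p : Defs.family k.+1) :
  tnth p ord0 = path_star -> exists l, star_at l p.
Proof.
move=> p0; pose P n := (n < k.+1)%N &&
  [forall b : 'I_k.+1, (0 < b <= n)%N ==> (tnth p b == path_dn b)].
have exP : exists n, P n.
  by exists 0%N; rewrite /P /=; apply/forallP => b; apply/implyP; lia.
have ubP n : P n -> (n <= k.+1)%N by case/andP => /ltnW.
case: (ex_maxnP exP ubP) => n /andP[nk /forallP dn_p] max_n.
exists (Ordinal nk); split=> // [b bn|b /= bn pb].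
  by apply/eqP; move/implyP: (dn_p b); apply.
(* A [path_dn] right after the longest run would extend it. *)
suff /max_n : P n.+1 by rewrite ltnn.
rewrite /P -bn ltn_ord; apply/forallP => c; apply/implyP => /andP[c0].
rewrite leq_eqVlt bn ltnS => /orP[/eqP cb|cn].
  by have -> : c = b; [apply: val_inj; rewrite /= cb bn|rewrite pb].
by move/implyP: (dn_p c); apply; rewrite c0.
Qed.

Definition cancelling k (p : Defs.family k.+1) : Prop :=
  exists l, star_at l p \/ low_at l p.

Lemma pth_tnth k (p : Defs.family k) (a : 'I_k) : pth p a.+1 = tnth p a.
Proof. by rewrite /pth (tnth_nth [::]). Qed.

Lemma cancellingE k (p : Defs.family k.+1) :
  cancelling p <-> [\/ property1 p, property2 p | property3 p].
Proof.
rewrite /property1 /property2 (pth_tnth p ord0); split.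
  move=> [l [[p0 _ _]|[pd pl]]]; first by constructor 1.
  case: (posnP l) => [l0|l0].
    by constructor 2; rewrite (_ : ord0 = l) ?pl ?l0 //; apply: val_inj.
  constructor 3; exists l.+1; split; first by rewrite ltnS l0 ltn_ord.
    move=> [//|m] /= ml; have mk := ltn_trans ml (ltn_ord l).
    by rewrite (pth_tnth p (Ordinal mk)) pd.
  by rewrite pth_tnth pl; case: (val l) l0.
case=> [/ex_star_at[l ?]|p0|[l [/andP[l0 lk] pd pl]]].
- by exists l; left.
- by exists ord0; right; split.
- case: l l0 lk pd pl => // l l0 lk pd pl.
  exists (Ordinal lk); right; split=> [b /= bl|].
    by rewrite -pth_tnth pd //= bl.
  by rewrite -pth_tnth pl /=; case: l l0 {lk pd pl}.
Qed.

(** The choice of [l] is unambiguous by [star_at_uniq] and [low_at_uniq], and the first two branches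
    exclude each other by [star_at_low_at]. *)
Definition swap k (p : Defs.family k.+1) : Defs.family k.+1 :=
  if [pick l | `[< star_at l p >]] is Some l then to_low l p
  else if [pick l | `[< low_at l p >]] is Some l then to_star l p
  else p.

Lemma swap_star_at k (l : 'I_k.+1) p : star_at l p -> swap p = to_low l p.
Proof.
move=> sl; rewrite /swap; case: pickP => [l' /asboolP sl'|/(_ l)/asboolP//].
by rewrite (star_at_uniq sl sl').
Qed.

Lemma swap_low_at k (l : 'I_k.+1) p : low_at l p -> swap p = to_star l p.
Proof.
move=> ll; rewrite /swap; case: pickP => [l' /asboolP/star_at_low_at/(_ ll)//|_].
case: pickP => [l' /asboolP ll'|/(_ l)/asboolP//].
by rewrite (low_at_uniq ll ll').
Qed.

Lemma sum_cancelling k (I J : k.+1.-tuple nat) :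
  sorted ltn I -> sorted ltn J ->
  \sum_(p \in nonintersecting I J `&` @cancelling k) family_weight p = 0.
Proof.
move=> hI hJ; have NE p := nonintersectingE p hI hJ.
apply: (fsum_sign_reversing (phi := @swap k)).
- by rewrite -polyC_natr polyC_eq0.
- move=> p [/NE vp [l [sl|ll]]].
    rewrite (swap_star_at sl); split; first by apply/NE/valid_to_low.
    by exists l; right; apply: low_at_to_low.
  rewrite (swap_low_at ll); split; first by apply/NE/valid_to_star.
  by exists l; left; apply: star_at_to_star vp.
- move=> p [/NE vp [l [sl|ll]]].
    by rewrite (swap_star_at sl) (swap_low_at (low_at_to_low sl)) to_lowK.
  by rewrite (swap_low_at ll) (swap_star_at (star_at_to_star ll vp)) to_starK.
- move=> p [/NE vp [l [sl|ll]]].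
    by rewrite (swap_star_at sl) family_weight_to_low.
  (* The family is written as the [to_low] of its [to_star], so the known sign change applies. *)
  rewrite (swap_low_at ll) -{2}(to_starK ll) family_weight_to_low ?opprK //.
  exact: star_at_to_star vp.
Qed.

Lemma S_IJ_E k (I J : k.+1.-tuple nat) :
  S_IJ I J = nonintersecting I J `&` ~` @cancelling k.
Proof.
apply/seteqP; split=> p.
  by move=> [Np n1 n2 n3]; split=> // /cancellingE[].
by move=> [Np nc]; split=> // ?; apply/nc/cancellingE;
  [constructor 1|constructor 2|constructor 3].
Qed.

(** * Nonnegativity of the coefficients and conclusion *)

Lemma prod_coef_ge0 (R : numDomainType) (T : eqType) (r : seq T) (F : T -> {poly R}) :
  (forall x, x \in r -> forall n, 0 <= (F x)`_n) ->
  forall n, 0 <= (\prod_(x <- r) F x)`_n.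
Proof.
move=> F0; rewrite big_seq; apply: (big_ind (fun P : {poly R} => forall n, 0 <= P`_n)) => //.
  by move=> n; rewrite coef1 ler0n.
by move=> P Q P0 Q0 n; rewrite coefM; apply: sumr_ge0 => i _; apply: mulr_ge0.
Qed.

(** The only arc of negative weight joins a source to a sink, so a path containing it consists of it
    alone. *)
Lemma path_weight_coef_ge0 i j p : is_dpath (vP i) (vP' j) p -> p <> path_star ->
  forall n, 0 <= (path_weight p)`_n.
Proof.
move=> dp nstar; apply: prod_coef_ge0 => e ep n.
have [e0|e0] := eqVneq e aP1P'0; last first.
  by case: e e0 {ep} => [?|?|?|?|||] /=; rewrite ?eqxx // => _; rewrite ?coefX ?coef1 ler0n.
rewrite e0 in ep; exfalso; apply: nstar.
have : p \in paths_via (descends p) i j by rewrite mem_paths_via dp eqxx.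
have noarc f m : f != aP1P'0 -> p \notin [seq [:: f; x] | x <- arcs_QP' m j].
  move=> f0; apply/mapP => -[x]; rewrite mem_arcs_QP' => /andP[xs _] pE.
  move: ep; rewrite pE !inE eq_sym (negPf f0) /= => /eqP x0.
  by rewrite -x0 in xs.
case: (descends p) => /=; last by rewrite (negPf (noarc _ _ _)).
case: (i) => // i'; rewrite mem_cat (negPf (noarc _ _ _)) //=.
by case: ifP => // _; rewrite inE => /eqP.
Qed.

(** As [J] increases, only the first path can end at P'_0; hence [path_star] could occur only there,
    which is property 1. *)
Lemma family_weight_coef_ge0 k (I J : k.+1.-tuple nat) p : sorted ltn J ->
  S_IJ I J p -> forall n, 0 <= (family_weight p)`_n.
Proof.
move=> hJ [[dp _] n1 _ _]; apply: prod_coef_ge0 => a _.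
apply: path_weight_coef_ge0 (dp a) _ => pa; apply: n1.
rewrite /property1 (pth_tnth p ord0).
have := dp a; rewrite pa is_dpath_star => /andP[_ /eqP Ja].
case: (posnP a) => [a0|a0]; first by rewrite (_ : ord0 = a) ?pa //; apply: val_inj.
by have := @sorted_tnth _ J hJ ord0 a a0; rewrite Ja.
Qed.

Theorem theorem3p2 (k : nat) (hk : (1 <= k)%N) (I J : k.-tuple nat)
    (hI : sorted ltn I) (hJ : sorted ltn J) :
  [/\ finite_set (S_IJ I J),
      \det (LB_sub I J) = GF (S_IJ I J)
    & forall n : nat, 0 <= (\det (LB_sub I J))`_n].
Proof.
case: k hk I J hI hJ => // k _ I J hI hJ.
have [finN sumN] := sum_nonintersecting hI hJ.
have finS : finite_set (S_IJ I J) by rewrite S_IJ_E; apply: finite_setIl.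
have detE : \det (LB_sub I J) = GF (S_IJ I J).
  (* The signed sum over all nonintersecting families splits into the cancelling part, which is 0,
     and the part over [S_IJ]. *)
  rewrite det_LB_sub // -sumN (fsbigID (@cancelling k)) //= sum_cancelling //.
  by rewrite add0r -S_IJ_E.
split=> // n; rewrite detE /GF fsbig_finite //.
rewrite coef_sum big_seq; apply: sumr_ge0 => p.
by rewrite in_fset_set // inE => /(family_weight_coef_ge0 hJ).
Qed.
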